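(* Let $l\ge 0$ and $n\ge 1$ be integers. The Lie superalgebra $\mathfrak{spo}(2l+2|n)$ is the space of matrices $A=\begin{pmatrix} A_1 & A_2 \\ A_3 & A_4 \end{pmatrix}\in\mathfrak{gl}(2l+2|n)$ (with $A_1$ of size $(2l+2)\times(2l+2)$ and $A_4$ of size $n\times n$) whose blocks satisfy 1. $A_1^tJ+JA_1=0$, i.e. $A_1\in\mathfrak{sp}(2l+2)$; 2. $A_4^t+A_4=0$, i.e. $A_4\in\mathfrak{o}(n)$; 3. $A_3=-A_2^tJ$.
   Context: $\mathbb{R}^{2l+2|n}=\mathbb{R}^{2l+2}\oplus\mathbb{R}^n$ is the real super vector space with even part $\mathbb{R}^{2l+2}$ and odd part $\mathbb{R}^n$; its elements are columns $U=\begin{pmatrix} U_1 \\ U_2 \end{pmatrix}$. $\mathfrak{gl}(2l+2|n)$ is the Lie superalgebra of real $(2l+2+n)\times(2l+2+n)$ matrices, where block-diagonal matrices ($A_2=0,A_3=0$) are even, block-off-diagonal matrices ($A_1=0,A_4=0$) are odd, with bracket the supercommutator. A tilde denotes parity, and $M^t$ is the usual transpose. Put $J=\begin{pmatrix} 0 & -\mathrm{id}_{l+1} \\ \mathrm{id}_{l+1} & 0 \end{pmatrix}$ and $G=\begin{pmatrix} J & 0 \\ 0 & \mathrm{id}_n \end{pmatrix}$, and define $\omega:\mathbb{R}^{2l+2|n}\times\mathbb{R}^{2l+2|n}\to\mathbb{R}$ by $\omega(U,V)=V^tGU$. $\mathfrak{spo}(2l+2|n)$ is defined as the set of matrices $A\in\mathfrak{gl}(2l+2|n)$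 that preserve $\omega$, i.e. such that $\omega(AU,V)+(-1)^{\tilde{A}\tilde{U}}\omega(U,AV)=0$ for all $U,V\in\mathbb{R}^{2l+2|n}$. The condition is written for homogeneous $A$ and $U$ and is extended by linearity: a general $A$ is in $\mathfrak{spo}(2l+2|n)$ when its even and odd parts are. *)

(* Defs.v *)
From HB Require Import structures.
From mathcomp Require Import all_boot all_order all_algebra.
From mathcomp Require Import classical_sets reals.
Set Implicit Arguments.
Unset Strict Implicit.
Unset Printing Implicit Defensive.
Import Order.TTheory GRing.Theory Num.Theory.
Local Open Scope ring_scope.

(* Parities are booleans, [false] being even and [true] odd.  The even
   dimension 2l+2 is written [l.+1 + l.+1], so that matrices in gl(2l+2|n) and
   J itself split into blocks definitionally. *)

Section Spo.
Variables (R : realType) (l n : nat).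

Definition superVect := 'cV[R]_((l.+1 + l.+1) + n).

Definition superGl := 'M[R]_((l.+1 + l.+1) + n).

(* The zero vector is homogeneous of both parities. *)
Definition homogeneous (p : bool) (U : superVect) : Prop :=
  if p then usubmx U = 0 else dsubmx U = 0.

Definition mx_part (p : bool) (A : superGl) : superGl :=
  if p then block_mx 0 (ursubmx A) (dlsubmx A) 0
  else block_mx (ulsubmx A) 0 0 (drsubmx A).

Definition Jmx : 'M[R]_(l.+1 + l.+1) := block_mx 0 (- 1%:M) 1%:M 0.

Definition Gmx : superGl := block_mx Jmx 0 0 1%:M.

Definition omega (U V : superVect) : R := (V^T *m Gmx *m U) 0 0.

(* Meant for [A] homogeneous of parity [p]; [V] need not be homogeneous. *)
Definition preserves_omega (p : bool) (A : superGl) : Prop :=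
  forall (q : bool) (U V : superVect), homogeneous q U ->
    omega (A *m U) V + (-1) ^+ (p && q) * omega U (A *m V) = 0.

Definition spo : set superGl :=
  [set A | forall p : bool, preserves_omega p (mx_part p A)]%classic.

End Spo.

Arguments Jmx : clear implicits.
Arguments spo : clear implicits.

(* Main.v *)
(* As omega U V = V^t G U, preservation of omega by A of parity p on vectors U
   of parity q says that (G A + (-1)^(pq) A^t G) U = 0.  Since U ranges over all
   of R^(2l+2) or all of R^n, this kills the first 2l+2, resp. the last n,
   columns of G A + (-1)^(pq) A^t G, which are then read off blockwise. *)

Require Import Defs.
From HB Require Import structures.
From mathcomp Require Import all_boot all_order all_algebra.
From mathcomp Require Import classical_sets reals.
Set Implicit Arguments.
Unset Strict Implicit.
Unset Printing Implicit Defensive.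
Import Order.TTheory GRing.Theory Num.Theory.
Local Open Scope ring_scope.

Lemma mulmx_cV_eq0 (R : pzRingType) (m n : nat) (M : 'M[R]_(m, n)) :
  (forall u : 'cV_n, M *m u = 0) -> M = 0.
Proof.
move=> M0; apply/matrixP => i j; have /colP/(_ i) := M0 (delta_mx j 0).
by rewrite -colE !mxE.
Qed.

Lemma mulmx_rV_cV_eq0 (R : pzRingType) (m : nat) (w : 'cV[R]_m) :
  (forall v : 'cV_m, (v^T *m w) 0 0 = 0) -> w = 0.
Proof.
move=> w0; apply/colP => i; have := w0 (delta_mx i 0).
by rewrite trmx_delta -rowE !mxE.
Qed.

Section SuperGl.
Variables (R : realType) (l n : nat).
Implicit Types (A : superGl R l n) (U V : superVect R l n).

Local Notation J := (Jmx R l).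
Local Notation G := (Gmx R l n).

Lemma trmx_Jmx : J^T = - J.
Proof.
by rewrite tr_block_mx opp_block_mx linearN /= !trmx0 !trmx1 !oppr0 opprK.
Qed.

(** For [c = 1] this is the derivative at t = 0 of the matrix of [omega] transported by exp(tA). The
    sign [c] stays free because an odd [A] meets both signs. *)
Definition omega_variation (c : R) A : superGl R l n :=
  G *m A + c *: (A^T *m G).

Lemma omega_variationE c A U V :
  omega (A *m U) V + c * omega U (A *m V) =
  (V^T *m (omega_variation c A *m U)) 0 0.
Proof.
rewrite /omega /omega_variation trmx_mul mulmxDl mulmxDr -!scalemxAl.
by rewrite -scalemxAr !mulmxA !mxE.
Qed.

(* On even [U] the sign is [1]; on odd [U], which only the last [n] columns
   see, it is [(-1) ^+ p]. *)
Lemma preserves_omegaP p A :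
  preserves_omega p A <->
  lsubmx (omega_variation 1 A) = 0 /\
  rsubmx (omega_variation ((-1) ^+ p) A) = 0.
Proof.
split=> [pA | [even0 odd0] q U V UE].
  (* Only [U] has to be homogeneous, so [V] can range over the whole space and detect every row. *)
  split; apply: mulmx_cV_eq0 => u; apply: mulmx_rV_cV_eq0 => V.
  - have := pA false (col_mx u 0) V (col_mxKd _ _).
    rewrite omega_variationE andbF -[omega_variation _ _]hsubmxK mul_row_col.
    by rewrite mulmx0 addr0 row_mxKl.
  - have := pA true (col_mx 0 u) V (col_mxKu _ _).
    rewrite omega_variationE andbT -[omega_variation _ _]hsubmxK mul_row_col.
    by rewrite mulmx0 add0r row_mxKr.
rewrite omega_variationE -(vsubmxK U) -[omega_variation _ _]hsubmxK.
case: q UE => /= UE; rewrite mul_row_col UE mulmx0 ?andbT ?andbF ?expr0.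
  by rewrite odd0 mul0mx addr0 mulmx0 mxE.
by rewrite even0 mul0mx addr0 mulmx0 mxE.
Qed.

Lemma omega_variation_block (c : R) (A1 : 'M_(l.+1 + l.+1))
    (A2 : 'M_(l.+1 + l.+1, n)) (A3 : 'M_(n, l.+1 + l.+1)) (A4 : 'M_n) :
  omega_variation c (block_mx A1 A2 A3 A4) =
  block_mx (J *m A1 + c *: (A1^T *m J)) (J *m A2 + c *: A3^T)
           (A3 + c *: (A2^T *m J)) (A4 + c *: A4^T).
Proof.
rewrite /omega_variation /Gmx tr_block_mx !mulmx_block scale_block_mx.
by rewrite add_block_mx !mulmx0 !mul0mx !mul1mx !mulmx1 !addr0 !add0r.
Qed.

(** The variation of the even part is block-diagonal: its left columns carry only the symplectic
    condition, its right columns only the orthogonal one. *)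
Lemma preserves_omega_even A :
  preserves_omega false (mx_part false A) <->
  (ulsubmx A)^T *m J + J *m ulsubmx A = 0 /\ (drsubmx A)^T + drsubmx A = 0.
Proof.
rewrite preserves_omegaP expr0 omega_variation_block !trmx0 !mul0mx !mulmx0.
rewrite !scaler0 !scale1r !addr0 block_mxEh row_mxKl row_mxKr.
rewrite addrC (addrC (drsubmx A)).
split=> [[/eqP + /eqP]|[-> ->]]; last by rewrite !col_mx0.
by rewrite !col_mx_eq0 => /andP[/eqP-> _] /andP[_ /eqP->].
Qed.

Lemma preserves_omega_odd A :
  preserves_omega true (mx_part true A) <->
  dlsubmx A = - ((ursubmx A)^T *m J).
Proof.
rewrite preserves_omegaP expr1 !omega_variation_block !trmx0 !mul0mx !mulmx0.
rewrite !scaler0 !scale1r !scaleN1r !addr0 !block_mxEh row_mxKl row_mxKr.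
split=> [[/eqP + _]|A3E].
  (* The lower half of the left columns is A3 + A2^t J. *)
  by rewrite col_mx_eq0 addr_eq0 => /andP[_ /eqP].
rewrite A3E addNr col_mx0; split=> //.
(* The condition on odd vectors is the transpose of the one on even vectors,
   as [J] is antisymmetric. *)
by rewrite linearN /= trmx_mul trmxK trmx_Jmx mulNmx opprK subrr col_mx0.
Qed.

End SuperGl.

Theorem theorem7p2 (R : realType) (l n : nat) (n_ge1 : (1 <= n)%N) :
  spo R l n =
  [set A : superGl R l n |
    [/\ (ulsubmx A)^T *m Jmx R l + Jmx R l *m ulsubmx A = 0,
        (drsubmx A)^T + drsubmx A = 0
      & dlsubmx A = - ((ursubmx A)^T *m Jmx R l)]]%classic.
Proof.
apply/seteqP; split=> A /=.
  move=> spoA; have [A1 A4] := (preserves_omega_even A).1 (spoA false).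
  by split=> //; apply/preserves_omega_odd/spoA.
(* The case split on the parity yields [true], the odd part, first. *)
by move=> [A1 A4 A3] []; [apply/preserves_omega_odd | apply/preserves_omega_even].
Qed.
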